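(* Let $d\ge 1$, $L>0$, and let $c_0>0$ be a constant. There is a constant $c>0$ depending only on $c_0$ such that for all integers $M\ge2$ and $n\ge1$ with $M\le c_0n$ there exist functions $p_1,\dots,p_M\in L_2(\mathbb{R}^d)$ such that $$\inf_{T_n}\sup_{p\in\mathcal{P}_0}\Big[R_n(T_n,p)-\inf_{\lambda\in\Lambda^M}\|\mathsf{p}_\lambda-p\|^2\Big]\ge \frac{cLM}{n},$$ where $\inf_{T_n}$ denotes the infimum over all estimators $T_n$ of $p$ based on $X_1,\dots,X_n$.
   Context: $X_1,\dots,X_n$ are i.i.d. random vectors in $\mathbb{R}^d$ with density $p$. $\|\cdot\|$ is the $L_2(\mathbb{R}^d)$ norm and $\|\cdot\|_\infty$ the $L_\infty(\mathbb{R}^d)$ norm. $\mathcal{P}_0$ is the class of all probability densities $p$ on $\mathbb{R}^d$ with $\|p\|_\infty\le L$. $\Lambda^M=\{\lambda\in\mathbb{R}^M:\lambda_j\ge0,\ \sum_{j=1}^M\lambda_j\le1\}$. For $\lambda\in\mathbb{R}^M$, $\mathsf{p}_\lambda=\sum_{j=1}^M\lambda_jp_j$; the functions $p_j$ need not be probability densities. For an estimator $T_n$ (a measurable function of the sample with values in functions on $\mathbb{R}^d$), $R_n(T_n,p)=E_p^n\|T_n-p\|^2$, where $E_p^n$ is the expectation with respect to the distribution of $(X_1,\dots,X_n)$ when the density is $p$. *)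

(* Defs.v *)
From HB Require Import structures.
From mathcomp Require Import all_boot all_order all_algebra.
From mathcomp Require Import all_classical all_reals all_analysis.
From mathcomp Require Import measurable_realfun.

Set Implicit Arguments.
Unset Strict Implicit.
Unset Printing Implicit Defensive.

Import Order.TTheory GRing.Theory Num.Theory.
Import numFieldNormedType.Exports.

Local Open Scope classical_set_scope.
Local Open Scope ring_scope.

Section tuple_cons.
Context d (T : measurableType d) (n : nat).

Definition tcons (u : T * n.-tuple T) : n.+1.-tuple T := [tuple of u.1 :: u.2].

Definition tuncons (x : n.+1.-tuple T) : T * n.-tuple T :=
  (thead x, [tuple of behead x]).

Lemma tconsK : cancel tcons tuncons.
Proof.
move=> [a b]; rewrite /tuncons /tcons theadE/=.
by congr pair; exact: val_inj.
Qed.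

Lemma measurable_tcons : measurable_fun setT tcons.
Proof. exact: measurable_cons. Qed.

Lemma measurable_tuncons : measurable_fun setT tuncons.
Proof.
apply: measurable_fun_pair; first exact: measurable_tnth.
exact: measurable_behead.
Qed.

End tuple_cons.

(* Product of mu and nu, transported to (n+1)-tuples by cons. *)
Section cons_measure.
Context d (T : measurableType d) (R : realType) (n : nat).
Variables (mu : {sigma_finite_measure set T -> \bar R})
          (nu : {sigma_finite_measure set (n.-tuple T) -> \bar R}).

Definition cons_measure : set (n.+1.-tuple T) -> \bar R :=
  pushforward (mu \x nu)%E (@tcons _ T n).

Let cons_measure0 : cons_measure set0 = 0%E.
Proof. by rewrite /cons_measure /pushforward preimage_set0 measure0. Qed.

Let cons_measure_ge0 A : (0 <= cons_measure A)%E.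
Proof. by rewrite /cons_measure /pushforward; exact: integral_ge0. Qed.

Let cons_measure_sigma_additive : semi_sigma_additive cons_measure.
Proof.
have mP A : measurable A -> measurable (@tcons _ T n @^-1` A).
  by move=> mA; rewrite -[X in measurable X]setTI; exact: measurable_tcons.
move=> F mF tF mUF; rewrite /cons_measure /pushforward preimage_bigcup.
apply: measure_semi_sigma_additive.
- by move=> k; exact: mP.
- by move=> i j _ _ [x [Fix Fjx]]; apply: (tF i j) => //; exists (tcons x).
- by rewrite -preimage_bigcup; exact: mP.
Qed.

HB.instance Definition _ := isMeasure.Build _ _ _ cons_measure
  cons_measure0 cons_measure_ge0 cons_measure_sigma_additive.

Lemma cons_measure_tuncons B :
  cons_measure (@tuncons _ T n @^-1` B) = (mu \x nu)%E B.
Proof.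
rewrite /cons_measure /pushforward -comp_preimage.
by rewrite (_ : _ \o _ = id)// funeqE => u /=; rewrite tconsK.
Qed.

Let cons_measure_sigma_finite : sigma_finite setT cons_measure.
Proof.
have /sigma_finiteP[F [TF ndF Foo]] := sigma_finiteT mu.
have /sigma_finiteP[G [TG ndG Goo]] := sigma_finiteT nu.
exists (fun i => @tuncons _ T n @^-1` (F i `*` G i)).
  apply/seteqP; split=> // x _.
  have [i _ Fx] : (\bigcup_i F i) (tuncons x).1 by rewrite -TF.
  have [j _ Gx] : (\bigcup_i G i) (tuncons x).2 by rewrite -TG.
  exists (maxn i j) => //; split.
    by move: Fx; exact/subsetPset/ndF/leq_maxl.
  by move: Gx; exact/subsetPset/ndG/leq_maxr.
move=> i; have [mF Fi] := Foo i; have [mG Gi] := Goo i; split.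
  rewrite -[X in measurable X]setTI; apply: measurable_tuncons => //.
  exact: measurableX.
rewrite cons_measure_tuncons product_measure1E//.
by rewrite lte_mul_pinfty// ge0_fin_numE.
Qed.

HB.instance Definition _ := Measure_isSigmaFinite.Build _ _ _ cons_measure
  cons_measure_sigma_finite.

End cons_measure.

Section power_measure.
Context d (T : measurableType d) (R : realType).
Variable mu : {sigma_finite_measure set T -> \bar R}.

(* n-fold product measure of mu, on n-tuples. *)
Fixpoint power_measure (n : nat) :
    {sigma_finite_measure set (n.-tuple T) -> \bar R} :=
  match n with
  | 0 => \d_([tuple] : 0.-tuple T)
  | m.+1 => cons_measure mu (power_measure m)
  end.

Lemma power_measureX n (A : 'I_n -> set T) : (forall i, measurable (A i)) ->
  power_measure n [set x | forall i, A i (tnth x i)] =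
  (\prod_(i < n) mu (A i))%E.
Proof.
elim: n A => [|n IHn] A mA /=.
  rewrite big_ord0 diracE mem_set//= => -[].
  by [].
rewrite big_ord_recl -IHn//.
set B := [set x : n.-tuple T | _].
have mB : measurable B.
  rewrite (_ : B = \bigcap_(i in [set: 'I_n])
      ((fun x : n.-tuple T => tnth x i) @^-1` A (lift ord0 i))).
    apply: fin_bigcap_measurable => // i _.
    by rewrite -[X in measurable X]setTI; exact: measurable_tnth.
  by apply/seteqP; split=> x /= Bx i; [move=> _|]; exact: Bx.
rewrite -product_measure1E// -cons_measure_tuncons; congr cons_measure.
apply/seteqP; split=> x /=; case/tupleP: x => a b;
  have -> : [tuple of behead [tuple of a :: b]] = b :> n.-tuple T
    by exact: val_inj.
- rewrite theadE => Ax; split=> /= [|i]; first exact: (Ax ord0).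
  by have := Ax (lift ord0 i); rewrite tnthS.
- rewrite theadE => -[/= Aa Bb] i; case: (unliftP ord0 i) => [j|] -> //.
  by rewrite tnthS; exact: Bb.
Qed.

End power_measure.

Section pdf.
Context d (T : measurableType d) (R : realType).
Variable mu : {measure set T -> \bar R}.

Record pdf := Pdf {
  pdf_fun :> T -> R;
  measurable_pdf : measurable_fun setT pdf_fun;
  pdf_ge0 : forall x, 0 <= pdf_fun x;
  integral_pdf : (\int[mu]_x (pdf_fun x)%:E)%E = 1%E }.

Definition pdf_law (p : pdf) : set T -> \bar R :=
  fun A => (\int[mu]_(x in A) (p x)%:E)%E.

Variable p : pdf.

Let pdf_law0 : pdf_law p set0 = 0%E.
Proof. by rewrite /pdf_law integral_set0. Qed.

Let pdf_law_ge0 A : (0 <= pdf_law p A)%E.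
Proof. by apply: integral_ge0 => x _; rewrite lee_fin pdf_ge0. Qed.

Let pdf_law_sigma_additive : semi_sigma_additive (pdf_law p).
Proof.
move=> F mF tF mUF; rewrite /pdf_law ge0_integral_bigcup//.
- by apply: is_cvg_ereal_nneg_natsum_cond => n _ _; exact: pdf_law_ge0.
- by apply/measurable_EFinP; apply: measurable_funTS; exact: measurable_pdf.
- by move=> x _; rewrite lee_fin pdf_ge0.
Qed.

HB.instance Definition _ := isMeasure.Build _ _ _ (pdf_law p)
  pdf_law0 pdf_law_ge0 pdf_law_sigma_additive.

HB.instance Definition _ :=
  @Measure_isProbability.Build _ _ R (pdf_law p) (integral_pdf p).

End pdf.

(* R^d as d-tuples, with the product of the Borel sigma-algebras. *)
Notation euclidean R d := (d.-tuple (measurableTypeR R)) (only parsing).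

Section aggregation.
Variables (R : realType) (d : nat).
Local Notation Rd := (euclidean R d).

Definition lebesgue_Rd : {sigma_finite_measure set Rd -> \bar R} :=
  power_measure (@lebesgue_measure R) d.

Definition L2norm (f : Rd -> R) : \bar R :=
  Lnorm lebesgue_Rd 2%:E (EFin \o f).

Definition Linfnorm (f : Rd -> R) : \bar R :=
  Lnorm lebesgue_Rd +oo%E (EFin \o f).

Definition bounded_pdfs (L : R) : set (pdf lebesgue_Rd) :=
  [set p : pdf lebesgue_Rd | (Linfnorm p <= L%:E)%E].

Definition subsimplex (M : nat) : set 'rV[R]_M :=
  [set lam : 'rV[R]_M | (forall j, 0 <= lam 0 j) /\ \sum_j lam 0 j <= 1].

Definition mixture (M : nat) (pj : 'I_M -> Rd -> R) (lam : 'rV[R]_M) :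
  Rd -> R := fun x => \sum_j lam 0 j * pj j x.

(* T s is the estimated function when the observed sample is s; measurability
   is joint in the sample and the point at which the estimate is evaluated. *)
Definition estimators (n : nat) : set (n.-tuple Rd -> Rd -> R) :=
  [set T : n.-tuple Rd -> Rd -> R |
    measurable_fun setT (fun u : n.-tuple Rd * Rd => T u.1 u.2)].

(* Extended-real valued because T s need not be square-integrable. *)
Definition risk (n : nat) (T : n.-tuple Rd -> Rd -> R)
    (p : pdf lebesgue_Rd) : \bar R :=
  (\int[power_measure (pdf_law p) n]_s (L2norm (T s \- p)%R ^+ 2))%E.

Definition oracle_risk (M : nat) (pj : 'I_M -> Rd -> R)
    (p : pdf lebesgue_Rd) : \bar R :=
  ereal_inf [set (L2norm (mixture pj lam \- p)%R ^+ 2)%E | lam in @subsimplex M].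

End aggregation.

Arguments subsimplex R M : clear implicits.
Arguments bounded_pdfs R d L : clear implicits.
Arguments estimators R d n : clear implicits.

(* Main.v *)
(* Assouad's method. Since the p_j need not be densities, taking p_j = M L 1_{A_j}
   for disjoint boxes A_j makes every combination of the L 1_{A_j} with
   coefficients in [0, 1] a mixture with weights in Lambda^M, so all the densities
   below have zero oracle risk. Pair up 2 m boxes of volume 1 / (m L), with m = M / 2
   rounded down, and for each sign vector perturb the height L / 2 by
   +delta L / 2 on one box of the i-th pair and by -delta L / 2 on the other, with
   delta^2 = m / (n (4 + c0)). Flipping one sign moves the density by
   2 delta^2 L / m in squared L2 norm, while the affinity of the n-samples stays
   at least 3 / 4. *)
Require Import Defs.
From mathcomp Require Import all_boot all_order all_algebra.
From mathcomp Require Import all_classical all_reals all_analysis.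
From mathcomp Require Import measurable_realfun ess_sup_inf ring lra zify.

Import Order.TTheory GRing.Theory Num.Theory.
Import numFieldNormedType.Exports.

Local Open Scope classical_set_scope.
Local Open Scope ring_scope.

(** * Integration against a law with a density and against powers of it *)

Section density.
Context {d} {T : measurableType d} {R : realType}.
Local Open Scope ereal_scope.

Import HBNNSimple.

(** Both sides pass to the limit along increasing simple functions [h n], and a simple function
    splits over its level sets. *)
Lemma integral_pdf_law (mu : {measure set T -> \bar R}) (p : pdf mu)
    (f : T -> \bar R) :
  measurable_fun setT f -> (forall x, 0 <= f x) ->
  \int[pdf_law p]_x f x = \int[mu]_x (f x * (p x)%:E).
Proof.
move=> mf f0; have mp : measurable_fun setT (EFin \o p).
  by apply/measurable_EFinP; exact: measurable_pdf.
have p0 x : 0 <= (p x)%:E by rewrite lee_fin pdf_ge0.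
pose h := nnsfun_approx measurableT mf.
have hf x : (EFin \o h n) x @[n --> \oo] --> f x by exact: cvg_nnsfun_approx.
have ndh x : {homo (fun n => (h n x)%:E) : a b / (a <= b)%N >-> a <= b}.
  by move=> a b ab; rewrite lee_fin; exact/lefP/nd_nnsfun_approx.
have -> : \int[pdf_law p]_x f x =
    limn (fun n => \int[pdf_law p]_x (h n x)%:E).
  under eq_integral => x _ do rewrite -(cvg_lim _ (hf x))//.
  apply: monotone_convergence => //.
  - by move=> n; exact/measurable_EFinP.
  - by move=> n x _; rewrite lee_fin.
  - by move=> x _ a b ab; exact: ndh.
have -> : \int[mu]_x (f x * (p x)%:E) =
    limn (fun n => \int[mu]_x ((h n x)%:E * (p x)%:E)).
  have hfp x : (h n x)%:E * (p x)%:E @[n --> \oo] --> f x * (p x)%:E.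
    by apply: cvgeZr => //; exact: hf.
  under eq_integral => x _ do rewrite -(cvg_lim _ (hfp x))//.
  apply: monotone_convergence => //.
  - move=> n; apply: emeasurable_funM => //; exact/measurable_EFinP.
  - by move=> n x _; rewrite mule_ge0// lee_fin.
  - by move=> x _ a b ab; rewrite lee_wpmul2r// ndh.
congr (limn _); apply/funext => n.
have mind r : measurable_fun setT (EFin \o (\1_(h n @^-1` [set r]) : T -> R)).
  exact/measurable_EFinP.
rewrite integralT_nnsfun sintegralE.
transitivity (\int[mu]_x (\sum_(r \in range (h n))
    (r * \1_(h n @^-1` [set r]) x)%:E * (p x)%:E)); last first.
  apply: eq_integral => x _; rewrite [in RHS]fimfunE -fsumEFin//.
  rewrite ge0_mule_fsuml// => r.
  exact: (nnfun_muleindic_ge0 (h n) r x).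
rewrite ge0_integral_fsum//; last 2 first.
- move=> r; apply: emeasurable_funM => //.
  exact: (measurable_funeM r%:E (mind r)).
- by move=> r x _; rewrite mule_ge0//; exact: nnfun_muleindic_ge0.
apply: eq_fsbigr => r; rewrite inE => -[x _ <-].
under eq_integral do rewrite EFinM -muleA.
rewrite ge0_integralZl//; last 3 first.
- exact: (emeasurable_funM (mind _) mp).
- by move=> y _; rewrite mule_ge0// lee_fin.
- by rewrite lee_fin.
(* On the indicator of a level set the claim is the definition of [pdf_law]. *)
congr (_ * _); rewrite /= /pdf_law integral_mkcond.
by apply: eq_integral => y _; rewrite epatch_indic muleC.
Qed.

(** Change of variables along [tcons], then Tonelli. This is the step that drives every induction on
    the sample size. *)
Lemma integral_cons_measure (n : nat)
    (mu : {sigma_finite_measure set T -> \bar R})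
    (nu : {sigma_finite_measure set (n.-tuple T) -> \bar R})
    (F : n.+1.-tuple T -> \bar R) :
  measurable_fun setT F -> (forall s, 0 <= F s) ->
  \int[cons_measure mu nu]_s F s =
  \int[mu]_x \int[nu]_y F (tcons (x, y)).
Proof.
move=> mF F0.
have mtc := @measurable_tcons _ T n.
rewrite -(fubini_tonelli1 (F \o @tcons _ T n)); last 2 first.
- exact: (measurableT_comp mF mtc).
- by move=> x; exact: F0.
rewrite -(preimage_setT (@tcons _ T n)).
by rewrite -(ge0_integral_pushforward mtc (mu \x nu)%E measurableT mF).
Qed.

(** For a density this is the joint density of an i.i.d. sample. It is also applied to minorants of
    [sqrt (p q)], to tensorise the affinity. *)
Definition tprod {n : nat} (g : T -> R) (s : n.-tuple T) : R :=
  \prod_(i < n) g (tnth s i).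

Lemma tprod_tcons (n : nat) (g : T -> R) (x : T) (y : n.-tuple T) :
  tprod g (tcons (x, y)) = (g x * tprod g y)%R.
Proof.
rewrite /tprod big_ord_recl; congr (_ * _)%R.
by apply: eq_bigr => i _; rewrite tnthS.
Qed.

Lemma measurable_tprod (n : nat) (g : T -> R) :
  measurable_fun setT g -> measurable_fun setT (tprod (n := n) g).
Proof.
move=> mg; apply: measurable_prod => i _.
by apply: measurableT_comp => //; exact: measurable_tnth.
Qed.

Lemma tprod_ge0 (n : nat) (g : T -> R) (s : n.-tuple T) :
  (forall x, (0 <= g x)%R) -> (0 <= tprod g s)%R.
Proof. by move=> g0; apply: prodr_ge0. Qed.

Lemma integral_power_measure_tprod (mu : {sigma_finite_measure set T -> \bar R})
    (n : nat) (g : T -> R) :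
  measurable_fun setT g -> (forall x, (0 <= g x)%R) ->
  \int[power_measure mu n]_s (tprod g s)%:E = (\int[mu]_x (g x)%:E) ^+ n.
Proof.
move=> mg g0; elim: n => [|n IHn].
  rewrite /= integral_dirac//.
    by rewrite diracT mul1e /tprod big_ord0.
  by apply/measurable_EFinP; exact: measurable_tprod.
rewrite [power_measure _ _]/= integral_cons_measure//; last 2 first.
- by apply/measurable_EFinP; exact: measurable_tprod.
- by move=> s; rewrite lee_fin tprod_ge0.
transitivity (\int[mu]_x ((g x)%:E * \int[power_measure mu n]_s (tprod g s)%:E)).
  apply: eq_integral => x _.
  under eq_integral do rewrite tprod_tcons EFinM.
  rewrite ge0_integralZl//.
  - by apply/measurable_EFinP; exact: measurable_tprod.
  - by move=> s _; rewrite lee_fin tprod_ge0.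
  - by rewrite lee_fin.
rewrite ge0_integralZr//; last 3 first.
- exact/measurable_EFinP.
- by move=> x _; rewrite lee_fin.
- by apply: integral_ge0 => s _; rewrite lee_fin tprod_ge0.
by rewrite IHn expeS.
Qed.

(** Induction on [n]: the tail of the sample is handled by the induction hypothesis, the first
    observation by [integral_pdf_law]. *)
Lemma integral_power_pdf_law (mu : {sigma_finite_measure set T -> \bar R})
    (p : pdf mu) (n : nat) (F : n.-tuple T -> \bar R) :
  measurable_fun setT F -> (forall s, 0 <= F s) ->
  \int[power_measure (pdf_law p) n]_s F s =
  \int[power_measure mu n]_s (F s * (tprod p s)%:E).
Proof.
have mp := measurable_pdf p; have p0 := pdf_ge0 p.
elim: n F => [|n IHn] F mF F0.
  by apply: eq_integral => s _; rewrite /tprod big_ord0 mule1.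
rewrite ![power_measure _ _]/= !integral_cons_measure//; last 2 first.
- apply: emeasurable_funM => //.
  by apply/measurable_EFinP; exact: measurable_tprod.
- by move=> s; rewrite mule_ge0// lee_fin tprod_ge0.
have mFt x : measurable_fun setT (fun y : n.-tuple T => F (tcons (x, y))).
  apply: (measurableT_comp mF); apply: (measurableT_comp (@measurable_tcons _ T n)).
  exact: measurable_pair1.
have mFp x : measurable_fun setT
    (fun y : n.-tuple T => F (tcons (x, y)) * (tprod p y)%:E).
  apply: emeasurable_funM => //.
  by apply/measurable_EFinP; exact: measurable_tprod.
under eq_integral do rewrite IHn//.
rewrite integral_pdf_law; last 2 first.
- apply: (measurable_fun_fubini_tonelli_F
    (fun u : T * n.-tuple T => F (tcons u) * (tprod p u.2)%:E)).
  + apply: emeasurable_funM.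
      exact: (measurableT_comp mF (@measurable_tcons _ T n)).
    apply/measurable_EFinP.
    exact: (measurableT_comp (measurable_tprod n p mp) measurable_snd).
  + by move=> u; rewrite mule_ge0// lee_fin tprod_ge0.
- by move=> x; apply: integral_ge0 => s _; rewrite mule_ge0// lee_fin tprod_ge0.
apply: eq_integral => x _; rewrite -ge0_integralZr//; last 2 first.
- by move=> s _; rewrite mule_ge0// lee_fin tprod_ge0.
- by rewrite lee_fin.
by apply: eq_integral => s _; rewrite tprod_tcons EFinM -muleA [in RHS](muleC (p x)%:E).
Qed.

End density.

(** * The two-point lower bound *)

(* Over [t], the weighted quadratic loss is at least [(u - v)^2 f g / (f + g)], and
   [f g / (f + g) >= h^2 / (f + g) >= h - (f + g) / 4]; this last bound is linear in
   the densities, so that it can be integrated term by term. *)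
Lemma two_point_ineq (R : realFieldType) (t u v f g h : R) :
  0 <= f -> 0 <= g -> h ^+ 2 <= f * g ->
  (u - v) ^+ 2 * h <=
  (t - u) ^+ 2 * f + (t - v) ^+ 2 * g + (u - v) ^+ 2 * (f + g) / 4.
Proof.
move=> f0 g0 hfg; have [S0|S0] := eqVneq (f + g) 0.
  have [-> ->] : f = 0 /\ g = 0.
    by move/eqP: S0; rewrite paddr_eq0// => /andP[/eqP-> /eqP->].
  have -> : h = 0.
    apply/eqP; rewrite -sqrf_eq0 eq_le sqr_ge0 andbT (le_trans hfg)//.
    by have /eqP := S0; rewrite paddr_eq0// => /andP[/eqP-> _]; rewrite mul0r.
  by rewrite !mulr0 !addr0 mulr0 mul0r.
have {}S0 : 0 < f + g by rewrite lt0r S0 addr_ge0.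
rewrite -(ler_pM2r S0) -subr_ge0.
(* After multiplication by [f + g], the gap is a square in [t], the slack in [h ^+ 2 <= f * g], and
   the square behind [h^2 / (f + g) >= h - (f + g) / 4]. *)
have -> : ((t - u) ^+ 2 * f + (t - v) ^+ 2 * g + (u - v) ^+ 2 * (f + g) / 4) *
      (f + g) - (u - v) ^+ 2 * h * (f + g) =
    ((t - u) * f + (t - v) * g) ^+ 2 + (u - v) ^+ 2 * (f * g - h ^+ 2) +
    (u - v) ^+ 2 * (h - (f + g) / 2) ^+ 2.
  by field.
by rewrite !addr_ge0 ?sqr_ge0// mulr_ge0 ?sqr_ge0// subr_ge0.
Qed.

Section two_point.
Context {d} {T : measurableType d} {R : realType}.
Variable mu : {sigma_finite_measure set T -> \bar R}.
Variable n : nat.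
Implicit Types (p q : pdf mu) (w h : T -> R) (t : n.-tuple T -> T -> R).
Local Open Scope ereal_scope.

(** The weight localises the quadratic loss: the indicator of one pair of boxes for Assouad's
    argument, the constant 1 for the full risk. *)
Definition weighted_risk t p w : \bar R :=
  \int[power_measure (pdf_law p) n]_s
    \int[mu]_x ((t s x - p x) ^+ 2 * w x)%:E.

Lemma integral_prod_tprod w h :
  measurable_fun setT w -> (forall x, (0 <= w x)%R) ->
  measurable_fun setT h -> (forall x, (0 <= h x)%R) ->
  \int[power_measure mu n \x mu]_z (w z.2 * tprod h z.1)%:E =
  \int[mu]_x (w x)%:E * (\int[mu]_x (h x)%:E) ^+ n.
Proof.
move=> mw w0 mh h0.
rewrite fubini_tonelli1; last 2 first.
- apply/measurable_EFinP; apply: measurable_funM.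
    exact: (measurableT_comp mw measurable_snd).
  exact: (measurableT_comp (measurable_tprod n h mh) measurable_fst).
- by move=> z; rewrite lee_fin mulr_ge0// tprod_ge0.
rewrite -integral_power_measure_tprod// -ge0_integralZl//; last 3 first.
- by apply/measurable_EFinP; exact: measurable_tprod.
- by move=> s _; rewrite lee_fin tprod_ge0.
- by apply: integral_ge0 => x _; rewrite lee_fin.
apply: eq_integral => s _; rewrite -ge0_integralZr//.
- exact/measurable_EFinP.
- by move=> x _; rewrite lee_fin.
- by rewrite lee_fin tprod_ge0.
Qed.

(** Moving the sample density into the integrand puts the risks under different densities on one
    common measure, where pointwise inequalities can be integrated. *)
Lemma weighted_riskE t p w :
  measurable_fun setT (fun u : n.-tuple T * T => t u.1 u.2) ->
  measurable_fun setT w -> (forall x, (0 <= w x)%R) ->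
  weighted_risk t p w = \int[power_measure mu n \x mu]_z
    ((t z.1 z.2 - p z.2) ^+ 2 * w z.2 * tprod p z.1)%:E.
Proof.
move=> mt mw w0; have mp := measurable_pdf p; have p0 := pdf_ge0 p.
have ml : measurable_fun setT (fun z : n.-tuple T * T =>
    ((t z.1 z.2 - p z.2) ^+ 2 * w z.2)%R).
  apply: measurable_funM; last exact: (measurableT_comp mw measurable_snd).
  apply: measurable_funX; apply: measurable_funB => //.
  exact: (measurableT_comp mp measurable_snd).
have l0 s x : (0 <= (t s x - p x) ^+ 2 * w x)%R by rewrite mulr_ge0// sqr_ge0.
rewrite fubini_tonelli1; last 2 first.
- apply/measurable_EFinP; apply: measurable_funM => //.
  exact: (measurableT_comp (measurable_tprod n p mp) measurable_fst).
- by move=> z; rewrite lee_fin mulr_ge0// tprod_ge0.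
rewrite /weighted_risk integral_power_pdf_law.
- apply: eq_integral => s _; rewrite -ge0_integralZr//.
  + apply/measurable_EFinP; exact: (measurableT_comp ml (measurable_pair1 s)).
  + by move=> x _; rewrite lee_fin.
  + by rewrite lee_fin tprod_ge0.
- apply: (measurable_fun_fubini_tonelli_F (fun z : n.-tuple T * T =>
    ((t z.1 z.2 - p z.2) ^+ 2 * w z.2)%:E)) => //.
    exact/measurable_EFinP.
  by move=> z; rewrite lee_fin.
- by move=> s; apply: integral_ge0 => x _; rewrite lee_fin.
Qed.

(* [h] plays the role of [sqrt (p q)], so that the power of its integral bounds the
   Hellinger affinity of the two [n]-samples from below. *)
Lemma two_point_bound t p q w h :
  measurable_fun setT (fun u : n.-tuple T * T => t u.1 u.2) ->
  measurable_fun setT w -> (forall x, (0 <= w x)%R) ->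
  measurable_fun setT h -> (forall x, (0 <= h x)%R) ->
  (forall x, (h x ^+ 2 <= p x * q x)%R) ->
  \int[mu]_x ((p x - q x) ^+ 2 * w x)%:E * (\int[mu]_x (h x)%:E) ^+ n <=
  weighted_risk t p w + weighted_risk t q w +
  (2^-1)%:E * \int[mu]_x ((p x - q x) ^+ 2 * w x)%:E.
Proof.
move=> mt mw w0 mh h0 hpq.
have mp := measurable_pdf p; have p0 := pdf_ge0 p.
have mq := measurable_pdf q; have q0 := pdf_ge0 q.
have expe1 k : (1 : \bar R) ^+ k = 1 by elim: k => // k IH; rewrite expeS IH mule1.
pose D x := ((p x - q x) ^+ 2 * w x)%R.
have D0 x : (0 <= D x)%R by rewrite mulr_ge0// sqr_ge0.
have mD : measurable_fun setT D.
  by apply: measurable_funM => //; apply: measurable_funX; exact: measurable_funB.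
have mtp (g : T -> R) : measurable_fun setT g ->
    measurable_fun setT (fun z : n.-tuple T * T => tprod g z.1).
  by move=> mg; exact: (measurableT_comp (measurable_tprod n g mg) measurable_fst).
have mDs : measurable_fun setT (fun z : n.-tuple T * T => D z.2).
  exact: (measurableT_comp mD measurable_snd).
have mDg (g : T -> R) : measurable_fun setT g ->
    measurable_fun setT (fun z : n.-tuple T * T => (D z.2 * tprod g z.1)%:E).
  move=> mg; apply/measurable_EFinP; apply: measurable_funM => //; exact: mtp.
have mW (g : pdf mu) : measurable_fun setT (fun z : n.-tuple T * T =>
    ((t z.1 z.2 - g z.2) ^+ 2 * w z.2 * tprod g z.1)%:E).
  have mg := measurable_pdf g.
  apply/measurable_EFinP; apply: measurable_funM; last exact: mtp.
  apply: measurable_funM; last exact: (measurableT_comp mw measurable_snd).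
  apply: measurable_funX; apply: measurable_funB => //.
  exact: (measurableT_comp mg measurable_snd).
have W0 (g : pdf mu) (z : n.-tuple T * T) :
    0 <= ((t z.1 z.2 - g z.2) ^+ 2 * w z.2 * tprod g z.1)%:E.
  rewrite lee_fin mulr_ge0//; first by rewrite mulr_ge0// sqr_ge0.
  by apply: tprod_ge0; exact: pdf_ge0.
have DE (g : pdf mu) : \int[mu]_x (D x)%:E =
    \int[power_measure mu n \x mu]_z (D z.2 * tprod g z.1)%:E.
  rewrite integral_prod_tprod//; last 2 first.
  - exact: measurable_pdf.
  - exact: pdf_ge0.
  by rewrite integral_pdf expe1 mule1.
(* The sample densities of [p] and [q] integrate to 1, so half the distance splits into the two
   quarter terms produced by [(f + g) / 4] in the pointwise inequality. *)
have -> : (2^-1)%:E * \int[mu]_x (D x)%:E =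
    (4^-1)%:E * \int[power_measure mu n \x mu]_z (D z.2 * tprod p z.1)%:E +
    (4^-1)%:E * \int[power_measure mu n \x mu]_z (D z.2 * tprod q z.1)%:E.
  rewrite -!DE -ge0_muleDl ?lee_fin ?invr_ge0//.
  by rewrite -EFinD; congr (_%:E * _); field.
rewrite !weighted_riskE// -integral_prod_tprod//.
rewrite -!ge0_integralZl ?lee_fin ?invr_ge0//; last 4 first.
- exact: mDg.
- by move=> z _; rewrite lee_fin mulr_ge0// tprod_ge0.
- exact: mDg.
- by move=> z _; rewrite lee_fin mulr_ge0// tprod_ge0.
have D40 (g : pdf mu) (z : n.-tuple T * T) :
    0 <= (4^-1)%:E * (D z.2 * tprod g z.1)%:E.
  rewrite -EFinM lee_fin; apply: mulr_ge0; first by rewrite invr_ge0 ler0n.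
  by apply: mulr_ge0 => //; apply: tprod_ge0; exact: pdf_ge0.
have mD4 (g : pdf mu) : measurable_fun setT (fun z : n.-tuple T * T =>
    (4^-1)%:E * (D z.2 * tprod g z.1)%:E).
  by apply: measurable_funeM; apply: mDg; exact: measurable_pdf.
rewrite -ge0_integralD// -ge0_integralD// -ge0_integralD//; last 4 first.
- by move=> z _; exact: adde_ge0.
- exact: emeasurable_funD.
- by move=> z _; exact: adde_ge0.
- exact: emeasurable_funD.
apply: ge0_le_integral => //.
- by move=> z _; rewrite lee_fin (mulr_ge0 (D0 _)) ?tprod_ge0.
- exact: (mDg h mh).
- apply: emeasurable_funD; exact: emeasurable_funD.
move=> z _; rewrite -!EFinM -!EFinD lee_fin.
have := @two_point_ineq _ (t z.1 z.2) (p z.2) (q z.2) (tprod p z.1)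
  (tprod q z.1) (tprod h z.1) (tprod_ge0 _ _ _ p0) (tprod_ge0 _ _ _ q0).
(* The bound [h ^+ 2 <= p * q] multiplies over the coordinates of the sample. *)
have -> : (tprod h z.1 ^+ 2 <= tprod p z.1 * tprod q z.1)%R.
  rewrite /tprod -prodrXl -big_split/=.
  by apply: ler_prod => i _; rewrite sqr_ge0/=.
move=> /(_ isT) /(ler_wpM2r (w0 z.2)).
rewrite /D => H; apply: le_trans (le_trans H _); lra.
Qed.

End two_point.

(** * Step functions over disjoint sets of equal measure *)

Section step_functions.
Context {d} {T : measurableType d} {R : realType} {K : finType}.
Variables (mu : {measure set T -> \bar R}) (A : K -> set T) (a : R).
Hypothesis mA : forall k, measurable (A k).
Hypothesis tA : trivIset setT A.
Hypothesis muA : forall k, mu (A k) = a%:E.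

Definition step (v : K -> R) (x : T) : R := \sum_k v k * \1_(A k) x.

(** The index [k] depends on [x] alone, so one case analysis evaluates several step functions at
    once and reduces pointwise claims to claims on heights. *)
Lemma stepP x :
  (exists k, forall v, step v x = v k) \/ (forall v, step v x = 0).
Proof.
have [[k Akx]|noA] := pselect (exists k, A k x); [left|right].
  exists k => v; rewrite /step (bigD1 k)//= big1 ?addr0.
    by rewrite indicE mem_set// mulr1.
  move=> j jk; rewrite indicE memNset ?mulr0// => Ajx.
  by move/eqP: jk; apply; apply: tA => //; exists x.
move=> v; rewrite /step big1// => k _.
by rewrite indicE memNset ?mulr0// => Akx; apply: noA; exists k.
Qed.

Lemma measurable_step v : measurable_fun setT (step v).
Proof.
by apply: measurable_sum => k; apply: measurable_funM => //; exact: measurable_indic.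
Qed.

Lemma step_ge0 (v : K -> R) x : (forall k, 0 <= v k) -> 0 <= step v x.
Proof. by move=> v0; have [[k ->]|->] := stepP x. Qed.

Lemma integral_step (v : K -> R) : (forall k, 0 <= v k) ->
  (\int[mu]_x (step v x)%:E)%E = (a * \sum_k v k)%:E.
Proof.
move=> v0; under eq_integral do rewrite /step -sumEFin.
rewrite ge0_integral_sum//; first last.
- by move=> k x _; rewrite lee_fin mulr_ge0.
- move=> k; apply/measurable_EFinP; apply: measurable_funM => //.
rewrite mulr_sumr -sumEFin; apply: eq_bigr => k _.
under eq_integral do rewrite EFinM.
rewrite ge0_integralZl//.
- by rewrite integral_indic// setIT muA -EFinM mulrC.
- by apply/measurable_EFinP; exact: measurable_indic.
- by rewrite lee_fin.
Qed.

End step_functions.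

(** * Assouad's argument over a hypercube of densities, after two elementary inequalities *)

Lemma bernoulli_ineq (R : realDomainType) (x : R) n :
  0 <= x <= 1 -> 1 - n%:R * x <= (1 - x) ^+ n.
Proof.
move=> /andP[x0 x1]; elim: n => [|n IHn]; first by rewrite mul0r subr0 expr0.
rewrite exprS; apply: le_trans (ler_wpM2l _ IHn); last by rewrite subr_ge0.
rewrite -natr1 -subr_ge0.
have -> : (1 - x) * (1 - n%:R * x) - (1 - (n%:R + 1) * x) = n%:R * (x * x).
  by ring.
by rewrite mulr_ge0// mulr_ge0.
Qed.

Lemma double_le (R : realType) (x : \bar R) (c : R) :
  (c%:E <= x + x -> (c / 2)%:E <= x)%E.
Proof. by case: x => [x||]//=; rewrite ?leey// -EFinD !lee_fin; lra. Qed.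

Section hypercube.
Context {d} {T : measurableType d} {R : realType}.
Variables (mu : {sigma_finite_measure set T -> \bar R}) (m n : nat).
Variables (A : 'I_m * bool -> set T) (a L delta : R).
Hypothesis mA : forall k, measurable (A k).
Hypothesis tA : trivIset setT A.
Hypothesis muA : forall k, mu (A k) = a%:E.
Hypothesis L0 : 0 < L.
Hypothesis aL : a * (m%:R * L) = 1.
Hypothesis delta01 : 0 <= delta <= 1.
Hypothesis small_delta : n%:R * delta ^+ 2 <= m%:R / 4.

Local Notation vertex := {ffun 'I_m -> bool}.

(** The exclusive or makes the sign [s k.1] choose which box of the pair is raised; the other is
    lowered by the same amount, so each pair keeps its mass. *)
Definition height (s : vertex) (k : 'I_m * bool) : R :=
  L / 2 * (1 + if s k.1 (+) k.2 then delta else - delta).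

Lemma height_itv s k : 0 <= height s k <= L.
Proof.
move: delta01 => /andP[d0 d1].
have Ld0 : 0 <= L * delta by rewrite mulr_ge0// ltW.
have LdL : L * delta <= L by rewrite ler_piMr// ltW.
by rewrite /height; case: (_ (+) _); apply/andP; split; lra.
Qed.

Lemma sum_pairs (v : 'I_m * bool -> R) :
  \sum_k v k = \sum_i (v (i, true) + v (i, false)).
Proof.
transitivity (\sum_i \sum_b v (i, b)); first by rewrite pair_bigA; apply: eq_bigr => -[].
by apply: eq_bigr => i _; rewrite big_bool.
Qed.

Definition cube_density (s : vertex) : T -> R := step A (height s).

Lemma cube_density_ge0 s x : 0 <= cube_density s x.
Proof. by apply: (step_ge0 A tA) => k; have /andP[] := height_itv s k. Qed.

Lemma integral_cube_density s : (\int[mu]_x (cube_density s x)%:E)%E = 1%E.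
Proof.
rewrite (integral_step mu A a mA muA); last first.
  by move=> k; have /andP[] := height_itv s k.
rewrite sum_pairs (eq_bigr (fun=> L)); last first.
  by move=> i _; rewrite /height/= addbT addbF; case: (s i) => /=; lra.
by rewrite sumr_const card_ord -mulr_natl aL.
Qed.

Definition cube_pdf (s : vertex) : pdf mu :=
  Pdf (measurable_step A mA (height s)) (cube_density_ge0 s)
    (integral_cube_density s).

Definition flip (i : 'I_m) (s : vertex) : vertex :=
  [ffun j => s j (+) (j == i)].

Lemma flipK i : involutive (flip i).
Proof. by move=> s; apply/ffunP => j; rewrite !ffunE addbK. Qed.

(** The indicator of the union of the two boxes of pair [i]. *)
Definition pair_weight (i : 'I_m) : T -> R := step A (fun k => (k.1 == i)%:R).

(** On each of the two boxes of pair [i], of measure [a], the heights differ by [L * delta] in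
    absolute value. *)
Lemma flip_distance s i :
  (\int[mu]_x ((cube_pdf s x - cube_pdf (flip i s) x) ^+ 2 *
               pair_weight i x)%:E)%E = (2 * a * (L * delta) ^+ 2)%:E.
Proof.
pose v (k : 'I_m * bool) := (k.1 == i)%:R * (L * delta) ^+ 2.
transitivity (\int[mu]_x (step A v x)%:E)%E.
  apply: eq_integral => x _; congr EFin.
  rewrite /= /cube_density /pair_weight.
  have [[k h]|h] := stepP (R := R) A tA x; rewrite !{}h; last by rewrite mulr0.
  rewrite /v /height ffunE; case: eqP => _; last by rewrite mulr0 mul0r.
  by case: (s _); case: k.2 => /=; field.
rewrite (integral_step mu A a mA muA); last first.
  by move=> k; rewrite mulr_ge0// sqr_ge0.
rewrite sum_pairs (bigD1 i)//= big1 => [|j /negbTE ji]; last first.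
  by rewrite /v ji !mul0r addr0.
by rewrite /v eqxx; congr EFin; rewrite mulr1n; ring.
Qed.

(** A minorant of the geometric mean of the two heights. On pair [i] that mean is
    [L / 2 * sqrt (1 - delta^2)], and dropping the square root only lowers it; elsewhere the heights
    coincide. *)
Definition pair_height (i : 'I_m) (s : vertex) (k : 'I_m * bool) : R :=
  if k.1 == i then L / 2 * (1 - delta ^+ 2) else height s k.

Lemma pair_height_ge0 i s k : 0 <= pair_height i s k.
Proof.
move: delta01 => /andP[d0 d1]; rewrite /pair_height; case: ifP => _.
  by rewrite mulr_ge0 ?subr_ge0 ?exprn_ile1// divr_ge0// ltW.
by have /andP[] := height_itv s k.
Qed.

(** On pair [i] this comes down to [(1 - e)^2 <= 1 - e] for [e = delta^2] in [0, 1]. *)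
Lemma affinity_le i s x :
  step A (pair_height i s) x ^+ 2 <= cube_pdf s x * cube_pdf (flip i s) x.
Proof.
move: delta01 => /andP[d0 d1].
rewrite /= /cube_density.
have [[k h]|h] := stepP (R := R) A tA x; rewrite !{}h; last by rewrite mulr0 expr0n.
rewrite /pair_height /height ffunE; case: eqP => [_|_]; last first.
  by rewrite addbF expr2.
set e := delta ^+ 2.
have /andP[e0 e1] : 0 <= e <= 1 by rewrite sqr_ge0 exprn_ile1.
have -> : L / 2 * (1 + (if s k.1 (+) k.2 then delta else - delta)) *
   (L / 2 * (1 + (if s k.1 (+) true (+) k.2 then delta else - delta))) =
   (L / 2) ^+ 2 * (1 - e).
  by rewrite /e; case: (s _); case: k.2 => /=; ring.
rewrite exprMn ler_wpM2l ?sqr_ge0// expr2; nra.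
Qed.

(** Relative to total mass 1, each of the two boxes of pair [i] loses [a * (L / 2) * delta^2]
    against the mean height [L / 2]. *)
Lemma integral_affinity i s :
  (\int[mu]_x (step A (pair_height i s) x)%:E)%E =
  (1 - a * L * delta ^+ 2)%:E.
Proof.
rewrite (integral_step mu A a mA muA); last exact: pair_height_ge0.
rewrite sum_pairs (eq_bigr (fun j => L - (j == i)%:R * (L * delta ^+ 2))).
  rewrite sumrB sumr_const card_ord -mulr_natl mulrBr aL.
  rewrite (bigD1 i)//= eqxx big1 => [|j /negbTE->]; last by rewrite mul0r.
  by congr EFin; rewrite mulr1n; ring.
move=> j _; rewrite /pair_height/=; case: eqP => _ /=; rewrite ?mulr1n ?mulr0n; first by field.
by rewrite /height/= addbT addbF; case: (s j) => /=; field.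
Qed.

(** Bernoulli's inequality at [delta^2 / m], since [a * L = 1 / m] and
    [n * delta^2 / m <= 1 / 4]. *)
Lemma affinity_ge i s :
  ((3 / 4)%:E <= (\int[mu]_x (step A (pair_height i s) x)%:E) ^+ n)%E.
Proof.
move: delta01 => /andP[d0 d1].
have m0 : 0 < m%:R :> R by rewrite ltr0n; case: i => j /= /(leq_ltn_trans _) ->.
have aLm : a * L = m%:R^-1.
  by apply: (mulfI (lt0r_neq0 m0)); rewrite mulfV ?gt_eqF// -[RHS]aL; ring.
rewrite integral_affinity -EFin_expe lee_fin aLm.
apply: le_trans (bernoulli_ineq _ _ _ _); last first.
  apply/andP; split; first by rewrite mulr_ge0 ?sqr_ge0// invr_ge0 ltW.
  rewrite mulrC ler_pdivrMr// mul1r.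
  by apply: (@le_trans _ _ 1); rewrite ?exprn_ile1// ler1n -(ltr0n R).
have : m%:R^-1 * (n%:R * delta ^+ 2) <= m%:R^-1 * (m%:R / 4).
  by rewrite ler_wpM2l// invr_ge0 ltW.
rewrite (mulrA m%:R^-1 m%:R) mulVf ?gt_eqF//; lra.
Qed.

Section risk_bound.
Variable t : n.-tuple T -> T -> R.
Hypothesis mt : measurable_fun setT (fun u : n.-tuple T * T => t u.1 u.2).
Local Open Scope ereal_scope.

Let mw i : measurable_fun setT (pair_weight i).
Proof. exact: measurable_step. Qed.

Let w0 i x : (0 <= pair_weight i x)%R.
Proof. by apply: (step_ge0 A tA) => k; rewrite ler0n. Qed.

(** With [D = 2 a (L delta)^2] the two-point bound leaves [3/4 D - 1/2 D = D / 4]. *)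
Lemma pair_risk_ge s i :
  (a * (L * delta) ^+ 2 / 2)%:E <=
  weighted_risk mu n t (cube_pdf s) (pair_weight i) +
  weighted_risk mu n t (cube_pdf (flip i s)) (pair_weight i).
Proof.
have := two_point_bound mu n t (cube_pdf s) (cube_pdf (flip i s)) _ _ mt (mw i)
  (w0 i) (measurable_step A mA (pair_height i s))
  (fun x => step_ge0 A tA _ x (pair_height_ge0 i s)) (affinity_le i s).
rewrite flip_distance -leeBlDr//; apply: le_trans.
have a0 : (0 <= a)%R by rewrite -lee_fin -(muA (i, true)).
have D0 : 0 <= (2 * a * (L * delta) ^+ 2)%:E.
  by rewrite lee_fin mulr_ge0 ?sqr_ge0// mulr_ge0.
rewrite leeBrDr//; apply: le_trans (lee_wpmul2l D0 (affinity_ge i s)).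
by rewrite -!EFinM -EFinD lee_fin; lra.
Qed.

(** The pairs of boxes are disjoint, so the weights add up to at most 1 at every point. *)
Lemma sum_pair_risk_le (p : pdf mu) :
  \sum_i weighted_risk mu n t p (pair_weight i) <= weighted_risk mu n t p (cst 1%R).
Proof.
under eq_bigr do rewrite weighted_riskE//.
rewrite weighted_riskE//.
have mtp : measurable_fun setT (fun z : n.-tuple T * T => tprod p z.1).
  exact: (measurableT_comp (measurable_tprod n p (measurable_pdf p)) measurable_fst).
have ml (w : T -> R) : measurable_fun setT w ->
   measurable_fun setT (fun z : n.-tuple T * T =>
    ((t z.1 z.2 - p z.2) ^+ 2 * w z.2 * tprod p z.1)%:E).
  move=> mw'; apply/measurable_EFinP; apply: measurable_funM => //.
  apply: measurable_funM; last exact: (measurableT_comp mw' measurable_snd).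
  apply: measurable_funX; apply: measurable_funB => //.
  exact: (measurableT_comp (measurable_pdf p) measurable_snd).
have p0 := tprod_ge0 n p _ (pdf_ge0 p).
have l0 i (z : n.-tuple T * T) :
    0 <= ((t z.1 z.2 - p z.2) ^+ 2 * pair_weight i z.2 * tprod p z.1)%:E.
  by rewrite lee_fin (mulr_ge0 (mulr_ge0 (sqr_ge0 _) (w0 _ _))).
rewrite -ge0_integral_sum//; last by move=> i; exact: ml.
apply: ge0_le_integral => //.
- by move=> z _; apply: sume_ge0.
- by apply: emeasurable_sum => i; exact: ml.
- exact: (ml (cst 1%R)).
move=> z _; rewrite sumEFin lee_fin -mulr_suml -mulr_sumr.
apply: ler_wpM2r => //; apply: ler_wpM2l; first exact: sqr_ge0.
rewrite /pair_weight; have [[k h]|h] := stepP (R := R) A tA z.2.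
  under eq_bigr do rewrite h.
  by rewrite (bigD1 k.1)//= eqxx big1 ?addr0// => j /negbTE; rewrite eq_sym => ->.
by under eq_bigr do rewrite h; rewrite big1//=.
Qed.

Lemma weighted_risk_ge0 (p : pdf mu) w : (forall x, (0 <= w x)%R) ->
  0 <= weighted_risk mu n t p w.
Proof.
move=> w_ge0; apply: integral_ge0 => s _; apply: integral_ge0 => x _.
by rewrite lee_fin mulr_ge0// sqr_ge0.
Qed.

(** The bound holds on average over the vertices: each of the [m] pairs contributes
    [a (L delta)^2 / 4], and [a m L = 1]. *)
Lemma hypercube_risk_ge : exists s : vertex,
  (delta ^+ 2 * L / 4)%:E <= weighted_risk mu n t (cube_pdf s) (cst 1%R).
Proof.
pose r s i := weighted_risk mu n t (cube_pdf s) (pair_weight i).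
pose N : R := #|{: vertex}|%:R.
have r_ge i : (N * (a * (L * delta) ^+ 2 / 4))%:E <= \sum_s r s i.
  have -> : (N * (a * (L * delta) ^+ 2 / 4) =
    N * (a * (L * delta) ^+ 2 / 2) / 2)%R by field.
  apply: double_le.
  (* Flipping sign [i] permutes the vertices, so twice the sum is a sum of two-point risks. *)
  rewrite {2}(reindex_inj (inv_inj (flipK i)))/= -big_split/=.
  apply: (@le_trans _ _ (\sum_(s : vertex) (a * (L * delta) ^+ 2 / 2)%:E)).
    by rewrite sumEFin sumr_const /N mulr_natl.
  by apply: lee_sum => s _; exact: pair_risk_ge.
have tot : (N * (delta ^+ 2 * L / 4))%:E <=
    \sum_s weighted_risk mu n t (cube_pdf s) (cst 1%R).
  apply: (@le_trans _ _ (\sum_s \sum_i r s i)); last first.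
    by apply: lee_sum => s _; exact: sum_pair_risk_le.
  rewrite exchange_big/=.
  apply: (@le_trans _ _ (\sum_(i < m) (N * (a * (L * delta) ^+ 2 / 4))%:E)).
    rewrite sumEFin sumr_const card_ord -[X in _ <= X%:E]mulr_natl lee_fin.
    have -> : (m%:R * (N * (a * (L * delta) ^+ 2 / 4)) =
      a * (m%:R * L) * (N * (delta ^+ 2 * L / 4)))%R by ring.
    by rewrite aL mul1r.
  by apply: lee_sum.
(* Otherwise every risk is finite and below the bound; as there is at least one vertex, the sum is
   then strictly below [N] times the bound. *)
apply: contrapT => /forallNP small.
have {}small s : weighted_risk mu n t (cube_pdf s) (cst 1%R) <
    (delta ^+ 2 * L / 4)%:E.
  by rewrite ltNge; apply/negP; exact: small.
have rfin s : weighted_risk mu n t (cube_pdf s) (cst 1%R) \is a fin_num.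
  rewrite ge0_fin_numE; first exact: lt_le_trans (small s) (leey _).
  by apply: weighted_risk_ge0 => x; exact: ler01.
move: tot; apply/negP; rewrite -ltNge.
under eq_bigr do rewrite -(fineK (rfin _)).
rewrite sumEFin lte_fin.
have -> : (N * (delta ^+ 2 * L / 4) = \sum_(s : vertex) (delta ^+ 2 * L / 4))%R.
  by rewrite sumr_const /N mulr_natl.
apply: ltr_sum.
  by apply/hasP; exists [ffun=> true]; rewrite ?mem_index_enum.
by move=> s _; rewrite -lte_fin fineK.
Qed.

End risk_bound.
End hypercube.

(** * Boxes and norms in Euclidean space *)

Section euclidean.
Context {R : realType} {d : nat}.
Local Notation Rd := (euclidean R d).
Local Notation mu := (lebesgue_Rd R d).

(** The boxes are slabs of a unit-width column: coordinate 0 is cut into intervals of length [a],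
    the others range over [0, 1), so the volume is [a] in every dimension [d >= 1]. *)
Definition cell_side (a : R) (j : nat) (i : 'I_d) : set (measurableTypeR R) :=
  if i == 0%N :> nat then `[j%:R * a, j.+1%:R * a[%classic else `[0, 1[%classic.

Definition cell (a : R) (j : nat) : set Rd :=
  [set x | forall i, cell_side a j i (tnth x i)].

Lemma measurable_cell_side a j i : measurable (cell_side a j i).
Proof. by rewrite /cell_side; case: ifP => _; exact: measurable_itv. Qed.

Lemma measurable_cell a j : measurable (cell a j).
Proof.
rewrite (_ : cell a j = \bigcap_(i in [set: 'I_d])
    ((fun x : Rd => tnth x i) @^-1` cell_side a j i)).
  apply: fin_bigcap_measurable => // i _.
  rewrite -[X in measurable X]setTI; apply: measurable_tnth => //.
  exact: measurable_cell_side.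
by apply/seteqP; split=> x /= xa i; [move=> _|]; exact: xa.
Qed.

Lemma lebesgue_cell a j : (0 < d)%N -> 0 <= a -> mu (cell a j) = a%:E.
Proof.
move=> d0 a0; rewrite /lebesgue_Rd power_measureX; last exact: measurable_cell_side.
rewrite (bigD1 (Ordinal d0))//= big1 ?mule1.
  rewrite /cell_side/= lebesgue_measure_itv/= lte_fin -subr_gt0 -natr1 mulrDl.
  rewrite mul1r addrAC subrr add0r; case: ltP => // a0'; last first.
    by congr EFin; apply/eqP; rewrite eq_le a0 a0'.
  by rewrite -EFinD; congr EFin; ring.
move=> i i0; rewrite /cell_side ifF.
  by rewrite lebesgue_measure_itv/= lte_fin ltr01 -EFinD subr0.
by apply/negbTE; apply: contra i0 => /eqP i0; apply/eqP; exact: val_inj.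
Qed.

Lemma trivIset_cell a : (0 < d)%N -> 0 < a -> trivIset setT (cell a).
Proof.
move=> d0 a0 j k _ _ [x [/= /(_ (Ordinal d0)) + /(_ (Ordinal d0))]].
rewrite /cell_side/= !in_itv/= => /andP[xj jx] /andP[xk kx].
have := le_lt_trans xj kx; have := le_lt_trans xk jx.
by rewrite !ltr_pM2r// !ltr_nat => ? ?; lia.
Qed.

Lemma sqr_L2norm (f : Rd -> R) :
  (L2norm f ^+ 2)%E = (\int[mu]_x (f x ^+ 2)%:E)%E.
Proof.
have sqrE (x : \bar R) : (0 <= x)%E -> (x ^+ 2 = poweR x 2)%E.
  case: x => [x||]//= x0; first by rewrite powR_mulrn// expr2.
  by rewrite mulyy pnatr_eq0.
rewrite sqrE ?Lnorm_ge0// poweR_Lnorm//.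
by apply: eq_integral => x _ /=; rewrite powR_mulrn// real_normK ?num_real.
Qed.

Lemma risk_weighted n (t : n.-tuple Rd -> Rd -> R) p :
  risk t p = weighted_risk mu n t p (cst 1).
Proof.
apply: eq_integral => s _; rewrite sqr_L2norm.
by apply: eq_integral => x _; rewrite mulr1.
Qed.

Lemma scaled_indic_Lfun2 (A : set Rd) (b : R) : measurable A ->
  (mu A < +oo)%E -> (fun x => b * \1_A x) \in Lfun mu 2%:E.
Proof.
move=> mA muA.
have mf : measurable_fun setT (fun x : Rd => b * \1_A x).
  by apply: measurable_funM => //; exact: measurable_indic.
apply/andP; rewrite !inE; split=> //=.
rewrite /finite_norm; apply: (@lty_poweRy _ _ 2) => //.
rewrite poweR_Lnorm//.
rewrite (eq_integral (fun x => (b ^+ 2)%:E * (\1_A x)%:E)%E); last first.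
  move=> x _ /=; rewrite powR_mulrn// real_normK ?num_real//.
  by rewrite indicE -EFinM exprMn; case: (_ \in _); rewrite ?expr1n ?expr0n.
rewrite ge0_integralZl//.
- by rewrite integral_indic// setIT lte_mul_pinfty// lee_fin sqr_ge0.
- by apply/measurable_EFinP; exact: measurable_indic.
- by rewrite lee_fin sqr_ge0.
Qed.

Lemma Linfnorm_le (f : Rd -> R) (L : R) :
  (forall x, 0 <= f x <= L) -> (Linfnorm f <= L%:E)%E.
Proof.
move=> fL; rewrite /Linfnorm unlock; case: ifPn => _; last first.
  (* In its default branch the norm is 0, and [0 <= L] is read off from the value of [f] at the
     origin. *)
  have /andP[f0] := fL (nseq_tuple d 0); rewrite lee_fin; exact: le_trans.
apply/ess_supP; apply: aeW => x /=.
by have /andP[f0 f1] := fL x; rewrite lee_fin ger0_norm.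
Qed.

End euclidean.

(** * Choice of the parameters and the minimax bound *)

Theorem theorem3p2 (R : realType) (c0 : R) (hc0 : 0 < c0) :
  exists c : R, 0 < c /\
  forall (d : nat) (L : R), (1 <= d)%N -> 0 < L ->
  forall M n : nat, (2 <= M)%N -> (1 <= n)%N -> M%:R <= c0 * n%:R ->
  exists pj : 'I_M -> euclidean R d -> R,
    (forall j, pj j \in Lfun (lebesgue_Rd R d) 2%:E) /\
    ((c * L * M%:R / n%:R)%:E <=
     ereal_inf [set
       ereal_sup [set risk T p - oracle_risk pj p | p in bounded_pdfs R d L]
       | T in estimators R d n])%E.
Proof.
(* The hypercube gives [delta^2 L / 4 = m L / (4 n (4 + c0))], and [m >= M / 3] supplies the
   remaining factor 3. *)
exists ((12 * (4 + c0))^-1); split.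
  by rewrite invr_gt0 mulr_gt0// addr_gt0.
move=> d L d1 L0 M n M2 n1 Mn.
pose m := M./2.
have m0 : (0 < m)%N by rewrite /m; lia.
have mR0 : 0 < m%:R :> R by rewrite ltr0n.
have n0 : 0 < n%:R :> R by rewrite ltr0n.
have M0 : 0 < M%:R :> R by rewrite ltr0n; lia.
have c40 : 0 < 4 + c0 by rewrite addr_gt0.
have mM : m%:R <= M%:R :> R by rewrite ler_nat /m; lia.
have M3m : M%:R <= 3 * m%:R :> R by rewrite -natrM ler_nat /m; lia.
pose a : R := (m%:R * L)^-1.
have a0 : 0 < a by rewrite invr_gt0 mulr_gt0.
have aL : a * (m%:R * L) = 1 by rewrite mulVf// gt_eqF// mulr_gt0.
(* In [4 + c0], the 4 yields [n delta^2 <= m / 4], and [c0] yields [delta <= 1] through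
   [m <= M <= c0 n]. *)
pose delta : R := Num.sqrt (m%:R / (n%:R * (4 + c0))).
have deltaE : delta ^+ 2 = m%:R / (n%:R * (4 + c0)).
  by rewrite sqr_sqrtr// divr_ge0 ?mulr_ge0// ltW.
have delta01 : 0 <= delta <= 1.
  rewrite sqrtr_ge0 -(@expr_le1 _ 2)// ?sqrtr_ge0// deltaE.
  rewrite ler_pdivrMr ?mulr_gt0// mul1r.
  by apply: le_trans mM (le_trans Mn _); rewrite mulrC ler_pM2l//; lra.
have small_delta : n%:R * delta ^+ 2 <= m%:R / 4.
  rewrite deltaE.
  have -> : n%:R * (m%:R / (n%:R * (4 + c0))) = m%:R / (4 + c0).
    by field; rewrite !gt_eqF.
  by rewrite ler_pM2l// lef_pV2 ?posrE//; lra.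
have card_pairs : (#|{: 'I_m * bool}| <= M)%N.
  by rewrite card_prod card_ord card_bool /m; lia.
(* The [2 m] boxes are numbered among the [M] cells; for odd [M] one cell is left without mass. *)
pose e (k : 'I_m * bool) : 'I_M := widen_ord card_pairs (enum_rank k).
have e_inj : injective e.
  by move=> k k' /(congr1 val) /= /val_inj /enum_rank_inj.
pose A k : set (euclidean R d) := cell a (e k).
have mA k : measurable (A k) by exact: measurable_cell.
have muA k : lebesgue_Rd R d (A k) = a%:E by apply: lebesgue_cell => //; exact: ltW.
have tA : trivIset setT A.
  move=> k k' _ _ /(trivIset_cell a d1 a0 _ _ I I) /val_inj; exact: e_inj.
pose pj (j : 'I_M) (x : euclidean R d) : R := (M%:R * L) * \1_(cell a j) x.
exists pj; split.
  move=> j; apply: scaled_indic_Lfun2; first exact: measurable_cell.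
  by rewrite lebesgue_cell ?ltry// ltW.
apply/ereal_infP => _ [t mt <-].
have [s hs] := hypercube_risk_ge (lebesgue_Rd R d) m n A a L delta mA tA muA L0 aL
  delta01 small_delta t mt.
set p := cube_pdf _ _ _ _ _ _ _ _ _ _ _ _ _ in hs.
have pL : bounded_pdfs R d L p.
  apply: Linfnorm_le => x; rewrite /p /= /cube_density.
  have [[k ->]|->] := stepP (R := R) A tA x; last by rewrite lexx ltW.
  exact: height_itv.
have oracle0 : (oracle_risk pj p <= 0)%E.
  apply: ereal_inf_lbound.
  (* As [e] is injective, the inner sum has at most one term; it is empty, hence 0, for a cell
     outside the range of [e]. *)
  exists (\row_j \sum_(k | e k == j) height m L delta s k / (M%:R * L)).
    split=> [j|].
      rewrite mxE; apply: sumr_ge0 => k _.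
      have /andP[h0 _] := height_itv m L delta L0 delta01 s k.
      by rewrite divr_ge0// mulr_ge0// ltW.
    under eq_bigr do rewrite mxE.
    rewrite (exchange_big_dep predT)//=.
    (* Heights are at most [L], so each weight is at most [1 / M], and there are at most [M]
       boxes. *)
    apply: (@le_trans _ _ (\sum_(k : 'I_m * bool) M%:R^-1)).
      apply: ler_sum => k _; rewrite (big_pred1 (e k)); last first.
        by move=> j; rewrite eq_sym.
      have /andP[_ hL] := height_itv m L delta L0 delta01 s k.
      by rewrite ler_pdivrMr ?mulr_gt0// mulKf// gt_eqF.
    rewrite sumr_const -[_ *+ _]mulr_natl ler_pdivrMr// mul1r ler_nat.
    exact: card_pairs.
  rewrite sqr_L2norm integral0_eq// => x _; congr EFin.
  apply/eqP; rewrite sqrf_eq0 subr_eq0; apply/eqP.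
  rewrite /mixture /p /= /cube_density /step /pj.
  under eq_bigr do rewrite mxE mulr_suml.
  rewrite (exchange_big_dep predT)//=; apply: eq_bigr => k _.
  rewrite (big_pred1 (e k)); last by move=> j; rewrite eq_sym.
  by rewrite mulrA divfK// gt_eqF// mulr_gt0.
apply: (@le_trans _ _ (risk t p - oracle_risk pj p)%E); last first.
  by apply: ereal_sup_ubound; exists p.
(* Subtracting a nonpositive oracle risk cannot lower the value. *)
apply: (@le_trans _ _ (risk t p)); last by rewrite leeDl// oppe_ge0.
rewrite risk_weighted; apply: le_trans hs; rewrite lee_fin deltaE.
rewrite -subr_ge0.
(* The sign of the difference is that of [3 m - M]. *)
have -> : m%:R / (n%:R * (4 + c0)) * L / 4 - (12 * (4 + c0))^-1 * L * M%:R / n%:R =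
  L * (3 * m%:R - M%:R) / (12 * (n%:R * (4 + c0))).
  by field; rewrite !gt_eqF.
by rewrite divr_ge0 ?mulr_ge0// ?subr_ge0// ltW.
Qed.
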